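(* Let $D_1,D_2$ be open domains in $\mathbb{C}(\mathbf{i}_1)$, let $(F_{e_k},G_{e_k})$ be a complex generating pair in $D_k$ for $k=1,2$, and let $(F,G)$ be the $\mathbf{j}^*$-generating pair in $D_1\times_eD_2$ determined by them. If $w_{e_k}:D_k\to\mathbb{C}(\mathbf{i}_1)$ is an $(F_{e_k},G_{e_k})$-pseudoanalytic function on $D_k$ for $k=1,2$, then the function $w:D_1\times_e D_2\to\mathbb{T}$ defined by $$w(z_1+z_2\mathbf{i}_2)=w_{e_1}(z_1-z_2\mathbf{i}_1)\,\mathbf{e}_1+w_{e_2}(z_1+z_2\mathbf{i}_1)\,\mathbf{e}_2\qquad\forall\, z_1+z_2\mathbf{i}_2\in D_1\times_eD_2$$ is an $(F,G)_{\mathbf{j}}$-pseudoanalytic function on $D_1\times_eD_2$, and $$\dot w(z_1+z_2\mathbf{i}_2)=\dot w_{e_1}(z_1-z_2\mathbf{i}_1)\,\mathbf{e}_1+\dot w_{e_2}(z_1+z_2\mathbf{i}_1)\,\mathbf{e}_2\qquad\forall\, z_1+z_2\mathbf{i}_2\in D_1\times_eD_2,$$ where $\dot w$ is the $(F,G)_{\mathbf{j}}$-derivative and $\dot w_{e_k}$ is the $(F_{e_k},G_{e_k})$-derivative.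
   Context: **Bicomplex numbers.** $\mathbb{T}=\{w_0+w_1\mathbf{i}_1+w_2\mathbf{i}_2+w_3\mathbf{j}: w_i\in\mathbb{R}\}$ is the commutative real algebra with $\mathbf{i}_1^2=\mathbf{i}_2^2=-1$, $\mathbf{j}^2=1$, $\mathbf{i}_1\mathbf{i}_2=\mathbf{i}_2\mathbf{i}_1=\mathbf{j}$. $\mathbb{C}(\mathbf{i}_1)=\{x+y\mathbf{i}_1\}$ and $\mathbb{D}=\{x+y\mathbf{j}\}$ ($x,y\in\mathbb{R}$). Every $\omega\in\mathbb{T}$ is uniquely $\omega=z_1+z_2\mathbf{i}_2$ with $z_1,z_2\in\mathbb{C}(\mathbf{i}_1)$. Conjugations: $\omega^{\dagger_1}=\overline{z}_1+\overline{z}_2\mathbf{i}_2$, $\omega^{\dagger_2}=z_1-z_2\mathbf{i}_2$, $\omega^{\dagger_3}=\overline{z}_1-\overline{z}_2\mathbf{i}_2$. With $\mathbf{e}_1=\frac{1+\mathbf{j}}2$, $\mathbf{e}_2=\frac{1-\mathbf{j}}2$ one has uniquely $z_1+z_2\mathbf{i}_2=(z_1-z_2\mathbf{i}_1)\mathbf{e}_1+(z_1+z_2\mathbf{i}_1)\mathbf{e}_2$. For $D_1,D_2\subset\mathbb{C}(\mathbf{i}_1)$, $D_1\times_e D_2=\{\zeta_1\mathbf{e}_1+\zeta_2\mathbf{e}_2:\zeta_1\in D_1,\zeta_2\in D_2\}$. **Operators.** With $z_k=x_k+y_k\mathbf{i}_1$, $\partial_{z_k}=\frac12(\partial_{x_k}-\mathbf{i}_1\partial_{y_k})$,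 $\partial_{\bar z_k}=\frac12(\partial_{x_k}+\mathbf{i}_1\partial_{y_k})$: $\partial_{\omega^{\dagger_1}}=\frac12(\partial_{\bar z_1}-\mathbf{i}_2\partial_{\bar z_2})$, $\partial_{\omega^{\dagger_2}}=\frac12(\partial_{z_1}+\mathbf{i}_2\partial_{z_2})$, $\partial_{\omega^{\dagger_3}}=\frac12(\partial_{\bar z_1}+\mathbf{i}_2\partial_{\bar z_2})$. Subscripts denote application of these operators. **Complex pairs.** A complex generating pair in an open set $D\subset\mathbb{C}(\mathbf{i}_1)$ is a pair of twice continuously differentiable functions $F,G:D\to\mathbb{C}(\mathbf{i}_1)$ with $\mathrm{Im}(\overline{F}G)\neq0$ on $D$. A function $w:D\to\mathbb{C}(\mathbf{i}_1)$ is $(F,G)$-pseudoanalytic if it is continuously differentiable and satisfies the Vekua equation $w_{\bar z}=a\,w+b\,\overline{w}$ with $a=-\frac{\overline{F}G_{\bar z}-F_{\bar z}\overline{G}}{F\overline{G}-\overline{F}G}$, $b=\frac{FG_{\bar z}-F_{\bar z}G}{F\overline{G}-\overline{F}G}$. Its $(F,G)$-derivative at $\zeta_0$ is $\dot w(\zeta_0)=\lim_{\zeta\to\zeta_0}\frac{w(\zeta)-\lambda_0F(\zeta)-\mu_0G(\zeta)}{\zeta-\zeta_0}$, where $\lambda_0,\mu_0\in\mathbb{R}$ are the unique constants with $w(\zeta_0)=\lambda_0F(\zeta_0)+\mu_0G(\zeta_0)$. **Bicomplex pairs.** Given complex generating pairs $(F_{e_k},G_{e_k})$ in open $D_k$ ($k=1,2$),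 the $\mathbf{j}^*$-generating pair they determine in $D_0=D_1\times_eD_2$ is $F(z_1+z_2\mathbf{i}_2)=F_{e_1}(z_1-z_2\mathbf{i}_1)\mathbf{e}_1+F_{e_2}(z_1+z_2\mathbf{i}_1)\mathbf{e}_2$, $G(z_1+z_2\mathbf{i}_2)=G_{e_1}(z_1-z_2\mathbf{i}_1)\mathbf{e}_1+G_{e_2}(z_1+z_2\mathbf{i}_1)\mathbf{e}_2$. A function $w:D_0\to\mathbb{T}$ is $(F,G)_{\mathbf{j}}$-pseudoanalytic if it has continuous first partial derivatives and satisfies the three $\mathbf{j}$-bicomplex Vekua equations $w_{\omega^{\dagger_k}}=a^{(k)}w+b^{(k)}w^{\dagger_3}$, $k=1,2,3$, with $$a^{(k)}=-\frac{F^{\dagger_k}G_{\omega^{\dagger_k}}-F_{\omega^{\dagger_k}}G^{\dagger_k}}{FG^{\dagger_3}-F^{\dagger_3}G},\qquad b^{(k)}=\frac{FG_{\omega^{\dagger_k}}-F_{\omega^{\dagger_k}}G}{FG^{\dagger_3}-F^{\dagger_3}G}.$$ Its $(F,G)_{\mathbf{j}}$-derivative at $\omega_0$ is $\dot w(\omega_0)=\lim\frac{w(\omega)-\lambda_0F(\omega)-\mu_0G(\omega)}{\omega-\omega_0}$ as $\omega\to\omega_0$ with $\omega-\omega_0$ invertible, where $\lambda_0,\mu_0\in\mathbb{D}$ are the unique constants with $w(\omega_0)=\lambda_0F(\omega_0)+\mu_0G(\omega_0)$. *)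

(* Defs.v *)
(* Stdlib reals with Coquelicot. *)
From Stdlib Require Import Reals.
From Coquelicot Require Import Coquelicot.

Open Scope C_scope.

(** * Bicomplex numbers *)

(** The pair [(z1, z2)] is the bicomplex number z1 + z2 i2 with z1, z2 in
    C(i1); the topology is Coquelicot's product topology. *)
Definition bicomplex : Set := (C * C)%type.

Declare Scope bicomplex_scope.
Delimit Scope bicomplex_scope with BC.
Bind Scope bicomplex_scope with bicomplex.

Definition CtoBC (z : C) : bicomplex := (z, RtoC 0).
Definition BCi1 : bicomplex := (Ci, RtoC 0).
Definition BCi2 : bicomplex := (RtoC 0, RtoC 1).
Definition BCj : bicomplex := (RtoC 0, Ci).

Definition BCplus (u v : bicomplex) : bicomplex :=
  (fst u + fst v, snd u + snd v).
Definition BCopp (u : bicomplex) : bicomplex := (- fst u, - snd u).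
Definition BCminus (u v : bicomplex) : bicomplex := BCplus u (BCopp v).
Definition BCmult (u v : bicomplex) : bicomplex :=
  (fst u * fst v - snd u * snd v, fst u * snd v + snd u * fst v).

(** (z1 + z2 i2)(z1 - z2 i2) = z1^2 + z2^2 lies in C(i1), so this is the inverse
    of every invertible element; see [BCinv_r]. *)
Definition BCinv (u : bicomplex) : bicomplex :=
  let n := fst u * fst u + snd u * snd u in (fst u / n, - snd u / n).
Definition BCdiv (u v : bicomplex) : bicomplex := BCmult u (BCinv v).

Infix "+" := BCplus : bicomplex_scope.
Notation "- u" := (BCopp u) : bicomplex_scope.
Infix "-" := BCminus : bicomplex_scope.
Infix "*" := BCmult : bicomplex_scope.
Infix "/" := BCdiv : bicomplex_scope.

Definition BCinvertible (u : bicomplex) : Prop :=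
  exists v : bicomplex, (u * v)%BC = CtoBC 1.

Definition hyperbolic (u : bicomplex) : Prop :=
  exists x y : R, u = (CtoBC x + CtoBC y * BCj)%BC.

Definition BCe1 : bicomplex := (CtoBC (/ 2) * (CtoBC 1 + BCj))%BC.
Definition BCe2 : bicomplex := (CtoBC (/ 2) * (CtoBC 1 - BCj))%BC.

Definition idem (u1 u2 : C) : bicomplex :=
  (CtoBC u1 * BCe1 + CtoBC u2 * BCe2)%BC.

(** Idempotent components of z1 + z2 i2. *)
Definition idem1 (u : bicomplex) : C := fst u - snd u * Ci.
Definition idem2 (u : bicomplex) : C := fst u + snd u * Ci.

(** The product D1 x_e D2. *)
Definition eprod (D1 D2 : C -> Prop) (u : bicomplex) : Prop :=
  exists u1 u2 : C, D1 u1 /\ D2 u2 /\ u = idem u1 u2.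

Inductive dagger : Set := dag1 | dag2 | dag3.

Definition BCconj (k : dagger) (u : bicomplex) : bicomplex :=
  match k with
  | dag1 => (Cconj (fst u), Cconj (snd u))
  | dag2 => (fst u, - snd u)
  | dag3 => (Cconj (fst u), - Cconj (snd u))
  end.

Lemma BC_decomp (z1 z2 : C) :
  (z1, z2) = (CtoBC z1 + CtoBC z2 * BCi2)%BC :> bicomplex.
Proof.
unfold BCplus, BCmult, CtoBC, BCi2; simpl; f_equal; ring.
Qed.

Lemma BC_units :
  (BCi1 * BCi1 = - CtoBC 1 /\ BCi2 * BCi2 = - CtoBC 1 /\ BCj * BCj = CtoBC 1 /\
   BCi1 * BCi2 = BCj /\ BCi2 * BCi1 = BCj)%BC.
Proof.
repeat split; unfold BCmult, BCopp, CtoBC, BCi1, BCi2, BCj; simpl;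
  apply injective_projections; apply injective_projections; simpl; ring.
Qed.

Lemma idem_decomp (u : bicomplex) : u = idem (idem1 u) (idem2 u).
Proof.
apply injective_projections; apply injective_projections; simpl; field.
Qed.

Lemma BCinv_r (u : bicomplex) : BCinvertible u -> (u * BCinv u)%BC = CtoBC 1.
Proof.
intros [v Hv]; destruct u as [a b], v as [c d].
assert (H1 : a * c - b * d = 1) by exact (f_equal fst Hv).
assert (H2 : a * d + b * c = 0) by exact (f_equal snd Hv).
assert (Hn : a * a + b * b <> 0).
{ intros H0; apply C1_nz.
  transitivity ((a * a + b * b) * (c * c + d * d)); [| rewrite H0; ring].
  transitivity ((a * c - b * d) * (a * c - b * d)
                + (a * d + b * c) * (a * d + b * c)); [| ring].
  rewrite H1, H2; ring. }
unfold BCmult, BCinv, CtoBC; simpl; f_equal; field; exact Hn.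
Qed.

(** * Real partial derivatives *)

(** Curves R -> C and R -> bicomplex are differentiated componentwise. *)
Definition ex_deriveC (g : R -> C) (t : R) : Prop :=
  ex_derive (fun s => fst (g s)) t /\ ex_derive (fun s => snd (g s)) t.
Definition DeriveC (g : R -> C) (t : R) : C :=
  (Derive (fun s => fst (g s)) t, Derive (fun s => snd (g s)) t).

Definition ex_deriveBC (g : R -> bicomplex) (t : R) : Prop :=
  ex_deriveC (fun s => fst (g s)) t /\ ex_deriveC (fun s => snd (g s)) t.
Definition DeriveBC (g : R -> bicomplex) (t : R) : bicomplex :=
  (DeriveC (fun s => fst (g s)) t, DeriveC (fun s => snd (g s)) t).

Definition slice_x (z : C) (t : R) : C := (t, Im z).
Definition slice_y (z : C) (t : R) : C := (Re z, t).

Definition pdx (f : C -> C) (z : C) : C :=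
  DeriveC (fun t => f (slice_x z t)) (Re z).
Definition pdy (f : C -> C) (z : C) : C :=
  DeriveC (fun t => f (slice_y z t)) (Im z).

Definition C1_on (D : C -> Prop) (f : C -> C) : Prop :=
  forall z, D z ->
    ex_deriveC (fun t => f (slice_x z t)) (Re z) /\
    ex_deriveC (fun t => f (slice_y z t)) (Im z) /\
    continuous (pdx f) z /\ continuous (pdy f) z.

Definition C2_on (D : C -> Prop) (f : C -> C) : Prop :=
  C1_on D f /\ C1_on D (pdx f) /\ C1_on D (pdy f).

Definition dzbar (f : C -> C) (z : C) : C :=
  / 2 * (pdx f z + Ci * pdy f z).

(** The four real coordinates of z1 + z2 i2, where z_k = x_k + y_k i1. *)
Inductive coord : Set := cx1 | cy1 | cx2 | cy2.

Definition BCcoord (c : coord) (u : bicomplex) : R :=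
  match c with
  | cx1 => Re (fst u)
  | cy1 => Im (fst u)
  | cx2 => Re (snd u)
  | cy2 => Im (snd u)
  end.

Definition BCslice (c : coord) (u : bicomplex) (t : R) : bicomplex :=
  match c with
  | cx1 => (slice_x (fst u) t, snd u)
  | cy1 => (slice_y (fst u) t, snd u)
  | cx2 => (fst u, slice_x (snd u) t)
  | cy2 => (fst u, slice_y (snd u) t)
  end.

Definition BCpd (c : coord) (f : bicomplex -> bicomplex) (u : bicomplex) :
  bicomplex := DeriveBC (fun t => f (BCslice c u t)) (BCcoord c u).

Definition BC_C1_on (D : bicomplex -> Prop) (f : bicomplex -> bicomplex) :
  Prop :=
  forall u, D u -> forall c,
    ex_deriveBC (fun t => f (BCslice c u t)) (BCcoord c u) /\
    continuous (BCpd c f) u.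

Section Wirtinger.
Local Open Scope bicomplex_scope.

Definition BCdz1 (f : bicomplex -> bicomplex) (u : bicomplex) : bicomplex :=
  CtoBC (/ 2) * (BCpd cx1 f u - BCi1 * BCpd cy1 f u).
Definition BCdz2 (f : bicomplex -> bicomplex) (u : bicomplex) : bicomplex :=
  CtoBC (/ 2) * (BCpd cx2 f u - BCi1 * BCpd cy2 f u).
Definition BCdz1bar (f : bicomplex -> bicomplex) (u : bicomplex) : bicomplex :=
  CtoBC (/ 2) * (BCpd cx1 f u + BCi1 * BCpd cy1 f u).
Definition BCdz2bar (f : bicomplex -> bicomplex) (u : bicomplex) : bicomplex :=
  CtoBC (/ 2) * (BCpd cx2 f u + BCi1 * BCpd cy2 f u).

(** The derivative with respect to the k-th conjugate of the variable. *)
Definition BCddag (k : dagger) (f : bicomplex -> bicomplex) (u : bicomplex) :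
  bicomplex :=
  match k with
  | dag1 => CtoBC (/ 2) * (BCdz1bar f u - BCi2 * BCdz2bar f u)
  | dag2 => CtoBC (/ 2) * (BCdz1 f u + BCi2 * BCdz2 f u)
  | dag3 => CtoBC (/ 2) * (BCdz1bar f u + BCi2 * BCdz2bar f u)
  end.

End Wirtinger.

(** * Complex generating pairs and pseudoanalytic functions *)

(** Functions on an open set D are represented by total functions; every notion
    below only depends on their values on D. *)

Definition generating_pair (D : C -> Prop) (F G : C -> C) : Prop :=
  C2_on D F /\ C2_on D G /\ forall z, D z -> Im (Cconj (F z) * G z) <> 0%R.

Definition vekua_a (F G : C -> C) (z : C) : C :=
  - ((Cconj (F z) * dzbar G z - dzbar F z * Cconj (G z)) /
     (F z * Cconj (G z) - Cconj (F z) * G z)).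
Definition vekua_b (F G : C -> C) (z : C) : C :=
  (F z * dzbar G z - dzbar F z * G z) /
  (F z * Cconj (G z) - Cconj (F z) * G z).

Definition pseudoanalytic (D : C -> Prop) (F G w : C -> C) : Prop :=
  C1_on D w /\
  forall z, D z ->
    dzbar w z = vekua_a F G z * w z + vekua_b F G z * Cconj (w z).

(** [is_FG_derive F G w z0 d]: the (F,G)-derivative of w at z0 exists and is d. *)
Definition is_FG_derive (F G w : C -> C) (z0 d : C) : Prop :=
  exists l m : R,
    unique (fun p : R * R =>
      w z0 = RtoC (fst p) * F z0 + RtoC (snd p) * G z0) (l, m) /\
    filterlim (fun z => (w z - RtoC l * F z - RtoC m * G z) / (z - z0))
      (locally' z0) (locally d).

(** * Bicomplex generating pairs and pseudoanalytic functions *)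

Definition jstar_pair (D1 D2 : C -> Prop) (Fe1 Ge1 Fe2 Ge2 : C -> C)
    (F G : bicomplex -> bicomplex) : Prop :=
  forall z1 z2 : C, eprod D1 D2 (z1, z2) ->
    F (z1, z2) = idem (Fe1 (z1 - z2 * Ci)) (Fe2 (z1 + z2 * Ci)) /\
    G (z1, z2) = idem (Ge1 (z1 - z2 * Ci)) (Ge2 (z1 + z2 * Ci)).

Section BicomplexVekua.
Local Open Scope bicomplex_scope.

Definition BCvekua_a (k : dagger) (F G : bicomplex -> bicomplex)
    (u : bicomplex) : bicomplex :=
  - ((BCconj k (F u) * BCddag k G u - BCddag k F u * BCconj k (G u)) /
     (F u * BCconj dag3 (G u) - BCconj dag3 (F u) * G u)).
Definition BCvekua_b (k : dagger) (F G : bicomplex -> bicomplex)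
    (u : bicomplex) : bicomplex :=
  (F u * BCddag k G u - BCddag k F u * G u) /
  (F u * BCconj dag3 (G u) - BCconj dag3 (F u) * G u).

Definition BCpseudoanalytic (D : bicomplex -> Prop)
    (F G w : bicomplex -> bicomplex) : Prop :=
  BC_C1_on D w /\
  forall k u, D u ->
    BCddag k w u =
      BCvekua_a k F G u * w u + BCvekua_b k F G u * BCconj dag3 (w u).

(** [is_FGj_derive F G w u0 d]: the (F,G)_j-derivative of w at u0 exists and
    is d. *)
Definition is_FGj_derive (F G w : bicomplex -> bicomplex)
    (u0 d : bicomplex) : Prop :=
  exists l m : bicomplex,
    unique (fun p : bicomplex * bicomplex =>
      hyperbolic (fst p) /\ hyperbolic (snd p) /\
      w u0 = fst p * F u0 + snd p * G u0) (l, m) /\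
    filterlim (fun u => (w u - l * F u - m * G u) / (u - u0))
      (within (fun u => BCinvertible (u - u0)) (locally u0)) (locally d).

End BicomplexVekua.

(* Main.v *)
Require Import Defs.
From Stdlib Require Import Reals Lra.
From Coquelicot Require Import Coquelicot.

(** Writing u = zeta1 e1 + zeta2 e2, the maps u |-> zeta1 = [idem1 u] and
    u |-> zeta2 = [idem2 u] are ring homomorphisms onto C that together are
    injective, so the bicomplex algebra is C x C with componentwise operations.
    The third conjugation becomes componentwise complex conjugation, the
    hyperbolic numbers become pairs of reals, and u is invertible exactly when
    both components are nonzero. Everything in the theorem therefore splits into
    two complex statements, once differentiation is seen to split too.

    For differentiation, zeta1 = z1 - z2 i1 = (x1 + y2) + (y1 - x2) i1 and
    zeta2 = z1 + z2 i1 = (x1 - y2) + (y1 + x2) i1. Each of the four real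
    coordinates thus moves only the real part or only the imaginary part of each
    component, with slope 1 or -1. So the partial derivatives of
    f = f1(zeta1) e1 + f2(zeta2) e2 are, up to sign, partial derivatives of f1
    and f2 on the two components, and no multivariate chain rule is involved
    ([lift_is_derive]). Substituting in the Wirtinger operators,
    the first two conjugate derivatives of f vanish and the third one is
    dzbar f1 e1 + dzbar f2 e2 ([lift_BCddag]). Applied to F, G and w this makes
    the first two bicomplex Vekua equations read 0 = 0, and turns the third into
    the pair of complex Vekua equations ([lift_pseudoanalytic]).

    For the derivative, the first point is that the complex (F,G)-derivative
    exists ([FG_derive_exists]). With real l, m such that w = l F + m G at z0,
    the Vekua equation says precisely that W = w - l F - m G has dzbar W = 0 at
    z0: the coefficients a and b are the ones for which F and G themselves solve
    the equation. As W is continuously differentiable, it is differentiable in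
    the real sense, and with the Cauchy-Riemann equation at z0 it is complex
    differentiable there. The bicomplex difference quotient at an invertible
    increment is the pair of complex quotients, so its limit is the pair of
    complex limits; uniqueness of the hyperbolic coefficients is uniqueness of
    the real coefficients in both components ([lift_FGj_derive]). *)

Local Open Scope C_scope.

(** * The idempotent components as ring homomorphisms *)

Ltac C_eq := apply injective_projections; simpl.
Ltac BC_coords := apply injective_projections; apply injective_projections; simpl.

Lemma idem_coords (a b : C) :
  idem a b = ((((fst a + fst b) / 2)%R, ((snd a + snd b) / 2)%R),
              (((snd b - snd a) / 2)%R, ((fst a - fst b) / 2)%R)).
Proof. BC_coords; field. Qed.

Lemma idem1_idem (a b : C) : idem1 (idem a b) = a.
Proof. C_eq; field. Qed.

Lemma idem2_idem (a b : C) : idem2 (idem a b) = b.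
Proof. C_eq; field. Qed.

(** The main tool for bicomplex identities: the homomorphism rules below reduce
    each of the two goals to an identity between complex numbers. *)
Lemma BC_ext (u v : bicomplex) : idem1 u = idem1 v -> idem2 u = idem2 v -> u = v.
Proof.
intros H1 H2; rewrite (idem_decomp u), (idem_decomp v), H1, H2; reflexivity.
Qed.

Lemma idem1_plus (u v : bicomplex) : idem1 (u + v)%BC = idem1 u + idem1 v.
Proof. C_eq; ring. Qed.

Lemma idem2_plus (u v : bicomplex) : idem2 (u + v)%BC = idem2 u + idem2 v.
Proof. C_eq; ring. Qed.

Lemma idem1_opp (u : bicomplex) : idem1 (- u)%BC = - idem1 u.
Proof. C_eq; ring. Qed.

Lemma idem2_opp (u : bicomplex) : idem2 (- u)%BC = - idem2 u.
Proof. C_eq; ring. Qed.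

Lemma idem1_minus (u v : bicomplex) : idem1 (u - v)%BC = idem1 u - idem1 v.
Proof. C_eq; ring. Qed.

Lemma idem2_minus (u v : bicomplex) : idem2 (u - v)%BC = idem2 u - idem2 v.
Proof. C_eq; ring. Qed.

Lemma idem1_mult (u v : bicomplex) : idem1 (u * v)%BC = idem1 u * idem1 v.
Proof. C_eq; ring. Qed.

Lemma idem2_mult (u v : bicomplex) : idem2 (u * v)%BC = idem2 u * idem2 v.
Proof. C_eq; ring. Qed.

Lemma idem1_CtoBC (z : C) : idem1 (CtoBC z) = z.
Proof. C_eq; ring. Qed.

Lemma idem2_CtoBC (z : C) : idem2 (CtoBC z) = z.
Proof. C_eq; ring. Qed.

Lemma idem1_conj3 (u : bicomplex) : idem1 (BCconj dag3 u) = Cconj (idem1 u).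
Proof. C_eq; ring. Qed.

Lemma idem2_conj3 (u : bicomplex) : idem2 (BCconj dag3 u) = Cconj (idem2 u).
Proof. C_eq; ring. Qed.

Lemma invertible_idem (u : bicomplex) :
  BCinvertible u -> idem1 u <> 0 /\ idem2 u <> 0.
Proof.
intros [v Hv].
assert (H1 := f_equal idem1 Hv); assert (H2 := f_equal idem2 Hv).
rewrite idem1_mult, idem1_CtoBC in H1; rewrite idem2_mult, idem2_CtoBC in H2.
split; intros E; rewrite E, Cmult_0_l in *; apply C1_nz; auto.
Qed.

(** Both components of v must be nonzero even for one component of the quotient:
    the inverse of v divides by the product of the two. *)
Lemma idem_div (u v : bicomplex) : idem1 v <> 0 -> idem2 v <> 0 ->
  (u / v)%BC = idem (idem1 u / idem1 v) (idem2 u / idem2 v).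
Proof.
intros H1 H2.
assert (Hv : BCinvertible v).
{ exists (idem (/ idem1 v) (/ idem2 v)).
  apply BC_ext.
  - rewrite idem1_mult, idem1_idem, idem1_CtoBC; field; exact H1.
  - rewrite idem2_mult, idem2_idem, idem2_CtoBC; field; exact H2. }
apply BCinv_r in Hv.
assert (E1 := f_equal idem1 Hv); assert (E2 := f_equal idem2 Hv).
rewrite idem1_mult, idem1_CtoBC in E1; rewrite idem2_mult, idem2_CtoBC in E2.
apply BC_ext; unfold BCdiv.
- rewrite idem1_mult, idem1_idem; unfold Cdiv; f_equal.
  transitivity (/ idem1 v * (idem1 v * idem1 (BCinv v))); [field; exact H1|].
  rewrite E1; ring.
- rewrite idem2_mult, idem2_idem; unfold Cdiv; f_equal.
  transitivity (/ idem2 v * (idem2 v * idem2 (BCinv v))); [field; exact H2|].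
  rewrite E2; ring.
Qed.

Lemma hyperbolic_idem (u : bicomplex) :
  hyperbolic u <-> exists a b : R, u = idem (RtoC a) (RtoC b).
Proof.
split.
- intros (x & y & ->); exists (x + y)%R, (x - y)%R; BC_coords; field.
- intros (a & b & ->); exists ((a + b) / 2)%R, ((a - b) / 2)%R; BC_coords; field.
Qed.

Lemma eprod_idem (D1 D2 : C -> Prop) (u : bicomplex) :
  eprod D1 D2 u <-> D1 (idem1 u) /\ D2 (idem2 u).
Proof.
split.
- intros (a & b & Ha & Hb & ->); rewrite idem1_idem, idem2_idem; auto.
- intros [Ha Hb]; exists (idem1 u), (idem2 u); auto using idem_decomp.
Qed.

(** * Topology in idempotent components *)

Lemma ball_coords (a b : C) (eps : R) :
  ball a eps b <-> (Rabs (fst b - fst a) < eps /\ Rabs (snd b - snd a) < eps)%R.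
Proof. split; intros [H1 H2]; split; assumption. Qed.

(** The real coordinates of an idempotent combination are half sums and half
    differences of those of its components, so the radius is not enlarged. *)
Lemma ball_idem (a0 b0 a b : C) (eps : R) :
  ball a0 eps a -> ball b0 eps b -> ball (idem a0 b0) eps (idem a b).
Proof.
rewrite !ball_coords; intros [H1 H2] [H3 H4].
apply Rabs_def2 in H1, H2, H3, H4.
rewrite !idem_coords.
split; apply ball_coords; split; apply Rabs_def1; simpl; lra.
Qed.

Lemma ball_idem12 (u v : bicomplex) (eps : R) : ball u (eps / 2) v ->
  ball (idem1 u) eps (idem1 v) /\ ball (idem2 u) eps (idem2 v).
Proof.
intros H.
destruct (proj1 (ball_coords (fst u) (fst v) (eps / 2)) (proj1 H)) as [H1 H2].
destruct (proj1 (ball_coords (snd u) (snd v) (eps / 2)) (proj2 H)) as [H3 H4].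
apply Rabs_def2 in H1, H2, H3, H4.
split; apply ball_coords; split; apply Rabs_def1; simpl; lra.
Qed.

Lemma continuous_idem1 (u : bicomplex) : continuous idem1 u.
Proof.
apply filterlim_locally; intros eps.
exists (pos_div_2 eps); intros v Hv; exact (proj1 (ball_idem12 _ _ _ Hv)).
Qed.

Lemma continuous_idem2 (u : bicomplex) : continuous idem2 u.
Proof.
apply filterlim_locally; intros eps.
exists (pos_div_2 eps); intros v Hv; exact (proj2 (ball_idem12 _ _ _ Hv)).
Qed.

Lemma filterlim_idem {T : Type} (Fl : (T -> Prop) -> Prop) {FF : Filter Fl}
    (f g : T -> C) (a b : C) :
  filterlim f Fl (locally a) -> filterlim g Fl (locally b) ->
  filterlim (fun t => idem (f t) (g t)) Fl (locally (idem a b)).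
Proof.
intros Hf Hg; apply filterlim_locally; intros eps.
apply (filter_imp (fun t => ball a eps (f t) /\ ball b eps (g t))).
- intros t [H1 H2]; apply ball_idem; assumption.
- apply filter_and; [apply Hf | apply Hg]; exists eps; auto.
Qed.

Lemma open_eprod (D1 D2 : C -> Prop) : open D1 -> open D2 -> open (eprod D1 D2).
Proof.
intros O1 O2 u Hu; apply eprod_idem in Hu; destruct Hu as [H1 H2].
apply (filter_imp (fun v => D1 (idem1 v) /\ D2 (idem2 v))).
- intros v; apply eprod_idem.
- apply filter_and.
  + apply (continuous_idem1 u), O1, H1.
  + apply (continuous_idem2 u), O2, H2.
Qed.

(** * Derivatives of curves *)

Definition is_deriveC (g : R -> C) (t : R) (l : C) : Prop :=
  is_derive (fun s => fst (g s)) t (fst l) /\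
  is_derive (fun s => snd (g s)) t (snd l).

Definition is_deriveBC (g : R -> bicomplex) (t : R) (l : bicomplex) : Prop :=
  is_deriveC (fun s => fst (g s)) t (fst l) /\
  is_deriveC (fun s => snd (g s)) t (snd l).

Lemma DeriveC_correct (g : R -> C) (t : R) :
  ex_deriveC g t -> is_deriveC g t (DeriveC g t).
Proof. intros [H1 H2]; split; apply Derive_correct; assumption. Qed.

Lemma is_deriveBC_unique (g : R -> bicomplex) (t : R) (l : bicomplex) :
  is_deriveBC g t l -> DeriveBC g t = l.
Proof.
intros [[H1 H2] [H3 H4]].
BC_coords; apply is_derive_unique; assumption.
Qed.

Lemma is_deriveBC_ex (g : R -> bicomplex) (t : R) (l : bicomplex) :
  is_deriveBC g t l -> ex_deriveBC g t.
Proof.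
intros [[H1 H2] [H3 H4]]; split; split; eexists; eassumption.
Qed.

Lemma is_deriveBC_ext_loc (g h : R -> bicomplex) (t : R) (l : bicomplex) :
  locally t (fun s => g s = h s) -> is_deriveBC g t l -> is_deriveBC h t l.
Proof.
intros E [[H1 H2] [H3 H4]].
assert (K : forall p : bicomplex -> R, locally t (fun s => p (g s) = p (h s))).
{ intros p; revert E; apply filter_imp; intros s ->; reflexivity. }
split; split.
- exact (is_derive_ext_loc _ _ _ _ (K (fun u => fst (fst u))) H1).
- exact (is_derive_ext_loc _ _ _ _ (K (fun u => snd (fst u))) H2).
- exact (is_derive_ext_loc _ _ _ _ (K (fun u => fst (snd u))) H3).
- exact (is_derive_ext_loc _ _ _ _ (K (fun u => snd (snd u))) H4).
Qed.

Lemma is_deriveC_affine (g : R -> C) (p s t0 : R) (l : C) :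
  is_deriveC g p l ->
  is_deriveC (fun t => g (p + s * (t - t0))%R) t0 (RtoC s * l).
Proof.
assert (Haff : is_derive (fun t => p + s * (t - t0))%R t0 s)
  by (auto_derive; [exact I | ring]).
assert (Hp : (p + s * (t0 - t0))%R = p) by ring.
intros [H1 H2]; rewrite <- Hp in H1, H2; split.
- replace (fst (RtoC s * l)) with (s * fst l)%R by (simpl; ring).
  exact (is_derive_comp (fun r => fst (g r)) _ t0 _ _ H1 Haff).
- replace (snd (RtoC s * l)) with (s * snd l)%R by (simpl; ring).
  exact (is_derive_comp (fun r => snd (g r)) _ t0 _ _ H2 Haff).
Qed.

Lemma is_deriveBC_idem (g1 g2 : R -> C) (t : R) (l1 l2 : C) :
  is_deriveC g1 t l1 -> is_deriveC g2 t l2 ->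
  is_deriveBC (fun s => idem (g1 s) (g2 s)) t (idem l1 l2).
Proof.
assert (K : forall (f g : R -> R) (a b c d : R),
  is_derive f t a -> is_derive g t b ->
  is_derive (fun s => c * f s + d * g s)%R t (c * a + d * b)%R).
{ intros f g a b c d Hf Hg.
  apply @is_derive_plus; apply is_derive_scal; assumption. }
intros [H1 H2] [H3 H4]; split; split.
- apply (is_derive_ext (fun s => / 2 * fst (g1 s) + / 2 * fst (g2 s))%R);
    [intros s; simpl; field |].
  replace (fst (fst (idem l1 l2))) with (/ 2 * fst l1 + / 2 * fst l2)%R
    by (simpl; field); auto.
- apply (is_derive_ext (fun s => / 2 * snd (g1 s) + / 2 * snd (g2 s))%R);
    [intros s; simpl; field |].
  replace (snd (fst (idem l1 l2))) with (/ 2 * snd l1 + / 2 * snd l2)%R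
    by (simpl; field); auto.
- apply (is_derive_ext (fun s => - / 2 * snd (g1 s) + / 2 * snd (g2 s))%R);
    [intros s; simpl; field |].
  replace (fst (snd (idem l1 l2))) with (- / 2 * snd l1 + / 2 * snd l2)%R
    by (simpl; field); auto.
- apply (is_derive_ext (fun s => / 2 * fst (g1 s) + - / 2 * fst (g2 s))%R);
    [intros s; simpl; field |].
  replace (snd (snd (idem l1 l2))) with (/ 2 * fst l1 + - / 2 * fst l2)%R
    by (simpl; field); auto.
Qed.

(** * Partial derivatives of an idempotent combination of two functions *)

Definition lift_on (D1 D2 : C -> Prop) (f : bicomplex -> bicomplex)
    (f1 f2 : C -> C) : Prop :=
  forall u, eprod D1 D2 u -> f u = idem (f1 (idem1 u)) (f2 (idem2 u)).

(** The partial of f(zeta1) along a bicomplex coordinate, read off from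
    zeta1 = (x1 + y2) + (y1 - x2) i1. *)
Definition pd1 (c : coord) (f : C -> C) (z : C) : C :=
  match c with
  | cx1 | cy2 => pdx f z
  | cy1 => pdy f z
  | cx2 => - pdy f z
  end.

(** Likewise for f(zeta2), from zeta2 = (x1 - y2) + (y1 + x2) i1. *)
Definition pd2 (c : coord) (f : C -> C) (z : C) : C :=
  match c with
  | cx1 => pdx f z
  | cy1 | cx2 => pdy f z
  | cy2 => - pdx f z
  end.

Lemma is_deriveC_ext (g h : R -> C) (t : R) (l : C) :
  (forall s, g s = h s) -> is_deriveC g t l -> is_deriveC h t l.
Proof.
intros E [H1 H2]; split; (eapply is_derive_ext; [| eassumption]);
  intros s; simpl; rewrite E; reflexivity.
Qed.

Lemma slice_x_affine (D : C -> Prop) (f : C -> C) (z : C) (s t0 : R) :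
  C1_on D f -> D z ->
  is_deriveC (fun t => f (slice_x z (Re z + s * (t - t0)))) t0
    (RtoC s * pdx f z).
Proof.
intros Hf Hz; destruct (Hf z Hz) as [H _].
exact (is_deriveC_affine _ _ _ _ _ (DeriveC_correct _ _ H)).
Qed.

Lemma slice_y_affine (D : C -> Prop) (f : C -> C) (z : C) (s t0 : R) :
  C1_on D f -> D z ->
  is_deriveC (fun t => f (slice_y z (Im z + s * (t - t0)))) t0
    (RtoC s * pdy f z).
Proof.
intros Hf Hz; destruct (Hf z Hz) as [_ [H _]].
exact (is_deriveC_affine _ _ _ _ _ (DeriveC_correct _ _ H)).
Qed.

Lemma is_deriveC_idem1_slice (D : C -> Prop) (f : C -> C) (c : coord)
    (u : bicomplex) :
  C1_on D f -> D (idem1 u) ->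
  is_deriveC (fun t => f (idem1 (BCslice c u t))) (BCcoord c u)
    (pd1 c f (idem1 u)).
Proof.
intros Hf Hu.
assert (Hx := fun s => slice_x_affine D f _ s (BCcoord c u) Hf Hu).
assert (Hy := fun s => slice_y_affine D f _ s (BCcoord c u) Hf Hu).
assert (E : forall z, RtoC (-1) * z = - z) by (intros z; C_eq; ring).
destruct c; simpl pd1.
- specialize (Hx 1%R); rewrite Cmult_1_l in Hx; revert Hx.
  apply is_deriveC_ext; intros s; f_equal; C_eq; unfold Re, Im; simpl; ring.
- specialize (Hy 1%R); rewrite Cmult_1_l in Hy; revert Hy.
  apply is_deriveC_ext; intros s; f_equal; C_eq; unfold Re, Im; simpl; ring.
- specialize (Hy (-1)%R); rewrite E in Hy; revert Hy.
  apply is_deriveC_ext; intros s; f_equal; C_eq; unfold Re, Im; simpl; ring.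
- specialize (Hx 1%R); rewrite Cmult_1_l in Hx; revert Hx.
  apply is_deriveC_ext; intros s; f_equal; C_eq; unfold Re, Im; simpl; ring.
Qed.

Lemma is_deriveC_idem2_slice (D : C -> Prop) (f : C -> C) (c : coord)
    (u : bicomplex) :
  C1_on D f -> D (idem2 u) ->
  is_deriveC (fun t => f (idem2 (BCslice c u t))) (BCcoord c u)
    (pd2 c f (idem2 u)).
Proof.
intros Hf Hu.
assert (Hx := fun s => slice_x_affine D f _ s (BCcoord c u) Hf Hu).
assert (Hy := fun s => slice_y_affine D f _ s (BCcoord c u) Hf Hu).
assert (E : forall z, RtoC (-1) * z = - z) by (intros z; C_eq; ring).
destruct c; simpl pd2.
- specialize (Hx 1%R); rewrite Cmult_1_l in Hx; revert Hx.
  apply is_deriveC_ext; intros s; f_equal; C_eq; unfold Re, Im; simpl; ring.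
- specialize (Hy 1%R); rewrite Cmult_1_l in Hy; revert Hy.
  apply is_deriveC_ext; intros s; f_equal; C_eq; unfold Re, Im; simpl; ring.
- specialize (Hy 1%R); rewrite Cmult_1_l in Hy; revert Hy.
  apply is_deriveC_ext; intros s; f_equal; C_eq; unfold Re, Im; simpl; ring.
- specialize (Hx (-1)%R); rewrite E in Hx; revert Hx.
  apply is_deriveC_ext; intros s; f_equal; C_eq; unfold Re, Im; simpl; ring.
Qed.

Lemma ball_BCslice (c : coord) (u : bicomplex) (t : R) (eps : posreal) :
  ball (BCcoord c u) eps t -> ball u eps (BCslice c u t).
Proof.
intros Ht; destruct u as [[x1 y1] [x2 y2]].
destruct c; split; split; simpl; try exact Ht; apply ball_center.
Qed.

Lemma locally_BCslice (c : coord) (u : bicomplex) (P : bicomplex -> Prop) :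
  locally u P -> locally (BCcoord c u) (fun t => P (BCslice c u t)).
Proof.
intros [eps H]; exists eps; intros t Ht; apply H, ball_BCslice, Ht.
Qed.

Section Lift.

Variables (D1 D2 : C -> Prop) (f1 f2 : C -> C) (f : bicomplex -> bicomplex).
Hypotheses (O1 : open D1) (O2 : open D2).
Hypotheses (Hf1 : C1_on D1 f1) (Hf2 : C1_on D2 f2).
Hypothesis Hf : lift_on D1 D2 f f1 f2.

Lemma lift_is_derive (c : coord) (u : bicomplex) : eprod D1 D2 u ->
  is_deriveBC (fun t => f (BCslice c u t)) (BCcoord c u)
    (idem (pd1 c f1 (idem1 u)) (pd2 c f2 (idem2 u))).
Proof.
intros Hu; destruct (proj1 (eprod_idem _ _ _) Hu) as [H1 H2].
apply (is_deriveBC_ext_loc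
  (fun t => idem (f1 (idem1 (BCslice c u t))) (f2 (idem2 (BCslice c u t))))).
- apply (locally_BCslice c u (fun v => idem (f1 (idem1 v)) (f2 (idem2 v)) = f v)).
  generalize (open_eprod _ _ O1 O2 u Hu); apply filter_imp.
  intros v Hv; symmetry; apply Hf, Hv.
- apply is_deriveBC_idem;
    [apply is_deriveC_idem1_slice with D1 | apply is_deriveC_idem2_slice with D2];
    assumption.
Qed.

Lemma lift_BCpd (c : coord) (u : bicomplex) : eprod D1 D2 u ->
  BCpd c f u = idem (pd1 c f1 (idem1 u)) (pd2 c f2 (idem2 u)).
Proof. intros Hu; apply is_deriveBC_unique, lift_is_derive, Hu. Qed.

Lemma lift_C1 : BC_C1_on (eprod D1 D2) f.
Proof.
intros u Hu c; split.
- eapply is_deriveBC_ex, lift_is_derive, Hu.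
- destruct (proj1 (eprod_idem _ _ _) Hu) as [H1 H2].
  destruct (Hf1 _ H1) as (_ & _ & Cx1 & Cy1).
  destruct (Hf2 _ H2) as (_ & _ & Cx2 & Cy2).
  unfold continuous; rewrite (lift_BCpd c u Hu).
  apply (filterlim_ext_loc
    (fun v => idem (pd1 c f1 (idem1 v)) (pd2 c f2 (idem2 v)))).
  { generalize (open_eprod _ _ O1 O2 u Hu); apply filter_imp.
    intros v Hv; symmetry; apply lift_BCpd, Hv. }
  apply filterlim_idem; [apply locally_filter | |].
  + apply (continuous_comp idem1 (pd1 c f1) u); [apply continuous_idem1 |].
    destruct c; simpl; try assumption.
    exact (continuous_opp (V := C_NormedModule) (pdy f1) _ Cy1).
  + apply (continuous_comp idem2 (pd2 c f2) u); [apply continuous_idem2 |].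
    destruct c; simpl; try assumption.
    exact (continuous_opp (V := C_NormedModule) (pdx f2) _ Cx2).
Qed.

(** The first conjugate of u has components (conj zeta2, conj zeta1) and the
    second one (zeta2, zeta1), while each component of f depends on its own
    zeta only: hence the two zeros. The third conjugate has components
    (conj zeta1, conj zeta2). *)
Lemma lift_BCddag (k : dagger) (u : bicomplex) : eprod D1 D2 u ->
  BCddag k f u =
  match k with
  | dag3 => idem (dzbar f1 (idem1 u)) (dzbar f2 (idem2 u))
  | _ => CtoBC 0
  end.
Proof.
intros Hu; destruct k; simpl;
  unfold BCdz1, BCdz2, BCdz1bar, BCdz2bar, dzbar;
  rewrite !(fun c => lift_BCpd c u Hu), ?idem_coords; simpl;
  unfold CtoBC, BCi1, BCi2; BC_coords; field.
Qed.

End Lift.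

(** * The bicomplex Vekua equations *)

(** This is the common denominator of the bicomplex Vekua coefficients, whose
    components are the denominators of the two complex pairs. *)
Lemma conj3_cross_idem (a b : bicomplex) :
  (a * BCconj dag3 b - BCconj dag3 a * b)%BC =
  idem (idem1 a * Cconj (idem1 b) - Cconj (idem1 a) * idem1 b)
       (idem2 a * Cconj (idem2 b) - Cconj (idem2 a) * idem2 b).
Proof.
apply BC_ext.
- rewrite idem1_minus, !idem1_mult, !idem1_conj3, idem1_idem; reflexivity.
- rewrite idem2_minus, !idem2_mult, !idem2_conj3, idem2_idem; reflexivity.
Qed.

(** The difference equals -2 Im(conj a b) i1. *)
Lemma vekua_denom_neq0 (a b : C) :
  Im (Cconj a * b) <> 0%R -> a * Cconj b - Cconj a * b <> 0.
Proof.
intros H E; apply H; apply (f_equal snd) in E; simpl in E.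
unfold Im; simpl; lra.
Qed.

Lemma lift_pseudoanalytic (D1 D2 : C -> Prop) (Fe1 Ge1 Fe2 Ge2 we1 we2 : C -> C)
    (F G w : bicomplex -> bicomplex) :
  open D1 -> open D2 ->
  generating_pair D1 Fe1 Ge1 -> generating_pair D2 Fe2 Ge2 ->
  lift_on D1 D2 F Fe1 Fe2 -> lift_on D1 D2 G Ge1 Ge2 ->
  lift_on D1 D2 w we1 we2 ->
  pseudoanalytic D1 Fe1 Ge1 we1 -> pseudoanalytic D2 Fe2 Ge2 we2 ->
  BCpseudoanalytic (eprod D1 D2) F G w.
Proof.
intros O1 O2 ([HF1 _] & [HG1 _] & N1) ([HF2 _] & [HG2 _] & N2) LF LG Lw
  [Hw1 V1] [Hw2 V2].
split; [exact (lift_C1 _ _ _ _ _ O1 O2 Hw1 Hw2 Lw) |].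
intros k u Hu; destruct (proj1 (eprod_idem _ _ _) Hu) as [H1 H2].
unfold BCvekua_a, BCvekua_b.
rewrite (lift_BCddag _ _ _ _ _ O1 O2 Hw1 Hw2 Lw k u Hu),
  (lift_BCddag _ _ _ _ _ O1 O2 HF1 HF2 LF k u Hu),
  (lift_BCddag _ _ _ _ _ O1 O2 HG1 HG2 LG k u Hu).
destruct k.
(* For the first two conjugations all derivatives are 0. *)
1,2: unfold BCdiv; apply BC_ext;
  rewrite ?idem1_plus, ?idem1_mult, ?idem1_opp, ?idem1_mult, ?idem1_minus,
    ?idem1_mult, ?idem1_CtoBC, ?idem2_plus, ?idem2_mult, ?idem2_opp,
    ?idem2_mult, ?idem2_minus, ?idem2_mult, ?idem2_CtoBC; ring.
specialize (N1 _ H1); specialize (N2 _ H2).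
apply vekua_denom_neq0 in N1; apply vekua_denom_neq0 in N2.
rewrite conj3_cross_idem, !idem_div;
  try (rewrite ?idem1_idem, ?idem2_idem, (LF u Hu), (LG u Hu),
         ?idem1_idem, ?idem2_idem; assumption).
apply BC_ext.
- rewrite idem1_idem, V1 by exact H1; unfold vekua_a, vekua_b.
  rewrite idem1_plus, !idem1_mult, idem1_opp, !idem1_idem, !idem1_minus,
    !idem1_mult, !idem1_conj3, (LF u Hu), (LG u Hu), (Lw u Hu), !idem1_idem.
  reflexivity.
- rewrite idem2_idem, V2 by exact H2; unfold vekua_a, vekua_b.
  rewrite idem2_plus, !idem2_mult, idem2_opp, !idem2_idem, !idem2_minus,
    !idem2_mult, !idem2_conj3, (LF u Hu), (LG u Hu), (Lw u Hu), !idem2_idem.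
  reflexivity.
Qed.

(** * The complex (F,G)-derivative *)

(** Frechet differentiability at z0 for the real structure of C, the
    differential being h |-> Re h px + Im h py. *)
Definition real_differential (f : C -> C) (z0 px py : C) : Prop :=
  forall eps : posreal, locally z0 (fun z =>
    (Cmod (f z - f z0 - (RtoC (Re (z - z0)) * px + RtoC (Im (z - z0)) * py))
     <= eps * Cmod (z - z0))%R).

Lemma real_differential_scal (c : C) (f : C -> C) (z0 px py : C) :
  real_differential f z0 px py ->
  real_differential (fun z => c * f z) z0 (c * px) (c * py).
Proof.
intros H eps.
assert (Hc : (0 < eps / (Cmod c + 1))%R).
{ apply Rdiv_lt_0_compat; [apply eps | generalize (Cmod_ge_0 c); lra]. }
generalize (H (mkposreal _ Hc)); apply filter_imp; intros z Hz.
change (pos (mkposreal _ Hc)) with (eps / (Cmod c + 1))%R in Hz.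
match goal with |- (Cmod ?e <= _)%R =>
  replace e with (c * (f z - f z0 -
    (RtoC (Re (z - z0)) * px + RtoC (Im (z - z0)) * py))) by ring end.
rewrite Cmod_mult.
apply Rle_trans with (Cmod c * (eps / (Cmod c + 1) * Cmod (z - z0)))%R.
{ apply Rmult_le_compat_l; [apply Cmod_ge_0 | exact Hz]. }
rewrite <- Rmult_assoc; apply Rmult_le_compat_r; [apply Cmod_ge_0 |].
generalize (Cmod_ge_0 c) (cond_pos eps); intros H0 H1.
apply Rmult_le_reg_r with (Cmod c + 1)%R; [lra |].
replace (Cmod c * (eps / (Cmod c + 1)) * (Cmod c + 1))%R with (Cmod c * eps)%R
  by (field; lra).
nra.
Qed.

Lemma real_differential_minus (f g : C -> C) (z0 px py qx qy : C) :
  real_differential f z0 px py -> real_differential g z0 qx qy ->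
  real_differential (fun z => f z - g z) z0 (px - qx) (py - qy).
Proof.
intros Hf Hg eps.
generalize (filter_and _ _ (Hf (pos_div_2 eps)) (Hg (pos_div_2 eps))).
apply filter_imp; intros z [H1 H2].
change (pos (pos_div_2 eps)) with (eps / 2)%R in H1, H2.
match goal with |- (Cmod ?e <= _)%R =>
  replace e with
   ((f z - f z0 - (RtoC (Re (z - z0)) * px + RtoC (Im (z - z0)) * py)) -
    (g z - g z0 - (RtoC (Re (z - z0)) * qx + RtoC (Im (z - z0)) * qy)))
  by ring end.
eapply Rle_trans; [apply Cmod_triangle |].
rewrite Cmod_opp; lra.
Qed.

Lemma Cmod_le_abs (z : C) (e : R) :
  (Rabs (fst z) <= e -> Rabs (snd z) <= e -> Cmod z <= 2 * e)%R.
Proof.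
intros H1 H2.
replace z with (RtoC (fst z) + Ci * RtoC (snd z)) by (C_eq; ring).
eapply Rle_trans; [apply Cmod_triangle |].
rewrite Cmod_mult, Cmod_Ci, !Cmod_R; lra.
Qed.

(** Partial derivatives that exist near z0, with one of them continuous at z0,
    give differentiability; this is applied to the real and the imaginary part
    of f separately. *)
Lemma C1_real_differential (D : C -> Prop) (f : C -> C) (z0 : C) :
  open D -> C1_on D f -> D z0 ->
  real_differential f z0 (pdx f z0) (pdy f z0).
Proof.
intros HO Hf Hz0.
assert (K : forall p : C -> R,
  (forall z, D z -> is_derive (fun t => p (f (slice_x z t))) (Re z) (p (pdx f z)))
  -> is_derive (fun t => p (f (slice_y z0 t))) (Im z0) (p (pdy f z0))
  -> (forall z, continuous p z)
  -> forall eps : posreal, locally z0 (fun z =>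
    Rabs (p (f z) - p (f z0) -
      (p (pdx f z0) * Re (z - z0) + p (pdy f z0) * Im (z - z0)))
    <= eps * Cmod (z - z0))%R).
{ intros p Hx Hy Hp eps.
  destruct (Hf z0 Hz0) as (_ & _ & Hc & _).
  destruct z0 as [x0 y0].
  assert (Hd : differentiable_pt_lim (fun x y => p (f (x, y))) x0 y0
                 (p (pdx f (x0, y0))) (p (pdy f (x0, y0)))).
  { apply filterdiff_differentiable_pt_lim.
    apply (is_derive_filterdiff (fun x y => p (f (x, y))) x0 y0
             (fun x y => p (pdx f (x, y)))).
    - generalize (HO _ Hz0); apply filter_imp; intros [x y]; exact (Hx (x, y)).
    - exact Hy.
    - apply (continuous_ext (fun u => p (pdx f u)));
        [intros [x y]; reflexivity |].
      exact (continuous_comp (pdx f) p (x0, y0) Hc (Hp _)). }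
  generalize (proj1 (locally_2d_locally _ _ _) (Hd eps)).
  apply filter_imp; intros [x y] Hz.
  eapply Rle_trans; [exact Hz |].
  apply Rmult_le_compat_l; [apply Rlt_le, cond_pos |].
  exact (Rmax_Cmod ((x, y) - (x0, y0))). }
intros eps.
assert (K1 := K fst (fun z Hz => proj1 (DeriveC_correct _ _ (proj1 (Hf z Hz))))
  (proj1 (DeriveC_correct _ _ (proj1 (proj2 (Hf z0 Hz0)))))
  (fun z => continuous_fst (fst z) (snd z)) (pos_div_2 eps)).
assert (K2 := K snd (fun z Hz => proj2 (DeriveC_correct _ _ (proj1 (Hf z Hz))))
  (proj2 (DeriveC_correct _ _ (proj1 (proj2 (Hf z0 Hz0)))))
  (fun z => continuous_snd (fst z) (snd z)) (pos_div_2 eps)).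
generalize (filter_and _ _ K1 K2); apply filter_imp; intros z [H1 H2].
replace (eps * Cmod (z - z0))%R with (2 * (eps / 2 * Cmod (z - z0)))%R by field.
apply Cmod_le_abs.
- eapply Rle_trans; [| exact H1]; right; f_equal; simpl; unfold Re, Im; ring.
- eapply Rle_trans; [| exact H2]; right; f_equal; simpl; unfold Re, Im; ring.
Qed.

(** A real differential satisfying the Cauchy-Riemann equation py = i px is
    multiplication by px, which makes the error term of the differential the
    error of the quotient. *)
Lemma quotient_limit (f : C -> C) (z0 d : C) :
  f z0 = 0 -> real_differential f z0 d (Ci * d) ->
  filterlim (fun z => f z / (z - z0)) (locally' z0) (locally d).
Proof.
intros H0 Hd; apply filterlim_locally; intros eps.
unfold locally', within.
generalize (Hd (pos_div_2 eps)); apply filter_imp.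
intros z Hz Hne.
change (pos (pos_div_2 eps)) with (eps / 2)%R in Hz.
assert (Hz0 : z - z0 <> 0).
{ intros E; apply Hne; change (@eq C z z0).
  replace z with (z - z0 + z0) by ring; rewrite E; ring. }
apply C_NormedModule_mixin_compat1.
change (Cmod (f z / (z - z0) - d) < eps)%R.
replace (f z / (z - z0) - d) with
  ((f z - f z0 - (RtoC (Re (z - z0)) * d + RtoC (Im (z - z0)) * (Ci * d)))
   / (z - z0)).
2:{ rewrite H0.
  replace (RtoC (Re (z - z0)) * d + RtoC (Im (z - z0)) * (Ci * d))
    with ((z - z0) * d) by (C_eq; unfold Re, Im; simpl; ring).
  field; exact Hz0. }
rewrite Cmod_div by exact Hz0.
apply Cmod_gt_0 in Hz0.
apply Rle_lt_trans with (eps / 2)%R; [| generalize (cond_pos eps); lra].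
apply Rmult_le_reg_r with (Cmod (z - z0)); [exact Hz0 |].
unfold Rdiv at 1; rewrite Rmult_assoc, Rinv_l by lra; lra.
Qed.

(** The condition says that a and b form a real basis of C; l and m are given by
    Cramer's rule. *)
Lemma real_coordinates (a b c : C) : Im (Cconj a * b) <> 0%R ->
  exists l m : R,
    unique (fun p : R * R => c = RtoC (fst p) * a + RtoC (snd p) * b) (l, m).
Proof.
destruct a as [a1 a2], b as [b1 b2], c as [c1 c2].
unfold Im; simpl; intros H.
assert (N : (a1 * b2 - a2 * b1)%R <> 0%R) by (intros E; apply H; lra).
exists ((c1 * b2 - c2 * b1) / (a1 * b2 - a2 * b1))%R,
  ((a1 * c2 - a2 * c1) / (a1 * b2 - a2 * b1))%R; split.
- C_eq; field; exact N.
- intros [x y] E; simpl in E.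
  assert (E1 := f_equal fst E); assert (E2 := f_equal snd E); simpl in E1, E2.
  f_equal; apply Rmult_eq_reg_r with (a1 * b2 - a2 * b1)%R; try exact N;
    rewrite E1, E2; field; exact N.
Qed.

(** The Vekua equation at z0 is the Cauchy-Riemann equation there for
    w - l F - m G. *)
Lemma FG_derive_exists (D : C -> Prop) (F G w : C -> C) (z0 : C) :
  open D -> generating_pair D F G -> pseudoanalytic D F G w -> D z0 ->
  exists d, is_FG_derive F G w z0 d.
Proof.
intros HO ([HF _] & [HG _] & N) [Hw V] Hz0.
destruct (real_coordinates (F z0) (G z0) (w z0) (N z0 Hz0)) as (l & m & Hlm).
exists (pdx w z0 - RtoC l * pdx F z0 - RtoC m * pdx G z0), l, m.
split; [exact Hlm |].
destruct Hlm as [E _]; simpl in E.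
apply quotient_limit; [rewrite E; ring |].
replace (Ci * (pdx w z0 - RtoC l * pdx F z0 - RtoC m * pdx G z0))
  with (pdy w z0 - RtoC l * pdy F z0 - RtoC m * pdy G z0).
{ repeat apply real_differential_minus; try apply real_differential_scal;
    apply C1_real_differential with D; assumption. }
(* F and G solve the Vekua equation with coefficients a and b, which is
   real-linear, so l F + m G does as well. *)
assert (Hbar : dzbar w z0 = RtoC l * dzbar F z0 + RtoC m * dzbar G z0).
{ rewrite V by exact Hz0.
  replace (Cconj (w z0)) with (RtoC l * Cconj (F z0) + RtoC m * Cconj (G z0))
    by (rewrite E; C_eq; ring).
  rewrite E; unfold vekua_a, vekua_b; field.
  apply vekua_denom_neq0, N, Hz0. }
assert (Hpd : forall f : C -> C,
  pdy f z0 = Ci * pdx f z0 - RtoC 2 * Ci * dzbar f z0).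
{ intros f; unfold dzbar; C_eq; field. }
rewrite !Hpd, Hbar; ring.
Qed.

(** * The bicomplex derivative *)

(** An invertible increment has a nonzero first component, as the punctured
    neighbourhoods in the complex derivative require. *)
Lemma filterlim_idem1_invertible (u0 : bicomplex) :
  filterlim idem1 (within (fun u => BCinvertible (u - u0)%BC) (locally u0))
    (locally' (idem1 u0)).
Proof.
intros P HP; assert (H := continuous_idem1 u0 _ HP).
revert H; unfold filtermap, within; apply filter_imp.
intros u Hu Hinv; apply Hu; intros E.
apply (proj1 (invertible_idem _ Hinv)); rewrite idem1_minus, E; ring.
Qed.

Lemma filterlim_idem2_invertible (u0 : bicomplex) :
  filterlim idem2 (within (fun u => BCinvertible (u - u0)%BC) (locally u0))
    (locally' (idem2 u0)).
Proof.
intros P HP; assert (H := continuous_idem2 u0 _ HP).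
revert H; unfold filtermap, within; apply filter_imp.
intros u Hu Hinv; apply Hu; intros E.
apply (proj2 (invertible_idem _ Hinv)); rewrite idem2_minus, E; ring.
Qed.

Lemma lift_FGj_derive (D1 D2 : C -> Prop) (Fe1 Ge1 Fe2 Ge2 we1 we2 : C -> C)
    (F G w : bicomplex -> bicomplex) (u0 : bicomplex) (d1 d2 : C) :
  open D1 -> open D2 ->
  lift_on D1 D2 F Fe1 Fe2 -> lift_on D1 D2 G Ge1 Ge2 ->
  lift_on D1 D2 w we1 we2 -> eprod D1 D2 u0 ->
  is_FG_derive Fe1 Ge1 we1 (idem1 u0) d1 ->
  is_FG_derive Fe2 Ge2 we2 (idem2 u0) d2 ->
  is_FGj_derive F G w u0 (idem d1 d2).
Proof.
intros O1 O2 LF LG Lw Hu0 (l1 & m1 & [E1 U1] & L1) (l2 & m2 & [E2 U2] & L2).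
simpl in E1, E2.
exists (idem (RtoC l1) (RtoC l2)), (idem (RtoC m1) (RtoC m2)); split; [split |].
- simpl; split; [| split]; try (apply hyperbolic_idem; eauto).
  rewrite (Lw _ Hu0), (LF _ Hu0), (LG _ Hu0); apply BC_ext.
  + rewrite idem1_plus, !idem1_mult, !idem1_idem; exact E1.
  + rewrite idem2_plus, !idem2_mult, !idem2_idem; exact E2.
- intros [l m]; simpl; intros (Hl & Hm & E).
  apply hyperbolic_idem in Hl, Hm.
  destruct Hl as (a & b & ->), Hm as (a' & b' & ->).
  rewrite (Lw _ Hu0), (LF _ Hu0), (LG _ Hu0) in E.
  assert (E1' := f_equal idem1 E); assert (E2' := f_equal idem2 E).
  rewrite idem1_plus, !idem1_mult, !idem1_idem in E1'.
  rewrite idem2_plus, !idem2_mult, !idem2_idem in E2'.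
  specialize (U1 (a, a') E1'); specialize (U2 (b, b') E2').
  injection U1 as -> ->; injection U2 as -> ->; reflexivity.
- apply (filterlim_ext_loc (fun u => idem
    ((we1 (idem1 u) - RtoC l1 * Fe1 (idem1 u) - RtoC m1 * Ge1 (idem1 u))
       / (idem1 u - idem1 u0))
    ((we2 (idem2 u) - RtoC l2 * Fe2 (idem2 u) - RtoC m2 * Ge2 (idem2 u))
       / (idem2 u - idem2 u0)))).
  + unfold within; generalize (open_eprod _ _ O1 O2 u0 Hu0); apply filter_imp.
    intros u Hu Hinv; destruct (invertible_idem _ Hinv) as [N1 N2].
    rewrite idem_div by assumption.
    rewrite (Lw _ Hu), (LF _ Hu), (LG _ Hu).
    rewrite !idem1_minus, !idem1_mult, !idem2_minus, !idem2_mult,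
      !idem1_idem, !idem2_idem; reflexivity.
  + apply filterlim_idem; [typeclasses eauto | |].
    * exact (filterlim_comp _ _ _ idem1 _ _ _ _
               (filterlim_idem1_invertible u0) L1).
    * exact (filterlim_comp _ _ _ idem2 _ _ _ _
               (filterlim_idem2_invertible u0) L2).
Qed.

Theorem theorem12 (D1 D2 : C -> Prop) (Fe1 Ge1 Fe2 Ge2 we1 we2 : C -> C)
    (F G w : bicomplex -> bicomplex)
    (hD1 : open D1) (hD2 : open D2)
    (hFG1 : generating_pair D1 Fe1 Ge1) (hFG2 : generating_pair D2 Fe2 Ge2)
    (hFG : jstar_pair D1 D2 Fe1 Ge1 Fe2 Ge2 F G)
    (hw1 : pseudoanalytic D1 Fe1 Ge1 we1) (hw2 : pseudoanalytic D2 Fe2 Ge2 we2)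
    (hw : forall z1 z2 : C, eprod D1 D2 (z1, z2) ->
       w (z1, z2) = idem (we1 (z1 - z2 * Ci)%C) (we2 (z1 + z2 * Ci)%C)) :
  BCpseudoanalytic (eprod D1 D2) F G w /\
  forall z1 z2 : C, eprod D1 D2 (z1, z2) ->
    exists d1 d2 : C,
      is_FG_derive Fe1 Ge1 we1 (z1 - z2 * Ci)%C d1 /\
      is_FG_derive Fe2 Ge2 we2 (z1 + z2 * Ci)%C d2 /\
      is_FGj_derive F G w (z1, z2) (idem d1 d2).
Proof.
assert (LF : lift_on D1 D2 F Fe1 Fe2) by (intros [z1 z2] Hu; apply hFG, Hu).
assert (LG : lift_on D1 D2 G Ge1 Ge2) by (intros [z1 z2] Hu; apply hFG, Hu).
assert (Lw : lift_on D1 D2 w we1 we2) by (intros [z1 z2] Hu; apply hw, Hu).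
split; [exact (lift_pseudoanalytic D1 D2 Fe1 Ge1 Fe2 Ge2 we1 we2 F G w
                 hD1 hD2 hFG1 hFG2 LF LG Lw hw1 hw2) |].
intros z1 z2 Hu; destruct (proj1 (eprod_idem _ _ _) Hu) as [H1 H2].
destruct (FG_derive_exists D1 Fe1 Ge1 we1 _ hD1 hFG1 hw1 H1) as [d1 Hd1].
destruct (FG_derive_exists D2 Fe2 Ge2 we2 _ hD2 hFG2 hw2 H2) as [d2 Hd2].
exists d1, d2; split; [exact Hd1 | split; [exact Hd2 |]].
exact (lift_FGj_derive D1 D2 Fe1 Ge1 Fe2 Ge2 we1 we2 F G w (z1, z2) d1 d2
         hD1 hD2 LF LG Lw Hu Hd1 Hd2).
Qed.
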